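(* Fix a natural number $m$. The logic $LTL_{Past,m}$ is decidable, and its satisfiability problem is decidable: there is an algorithm which, for any formula, determines whether it is satisfiable (true at some state of some model of $LTL_{Past,m}$) and, if so, computes a valuation of a model satisfying the formula.
   Context: Formulas are built from propositional letters by Boolean connectives, the unary operation $\mathbf{N}$ (next) and the binary operation $\mathbf{S}$ (since). Fix a natural number $m$ (measure of intransitivity). A frame is $\langle \mathbb{N},\geq,\mathrm{Next},\bigcup_{i\in\mathbb{N}}R_i\rangle$ where $R_i$ is the order $\geq$ restricted to the interval $[i,i+m]$ (so $b\,R_a\,a$ iff $a\le b\le a+m$). A model is such a frame with a valuation $V$ assigning to each letter a subset of $\mathbb{N}$. Truth: letters via $V$; Boolean connectives as usual; $(\mathcal{M},a)\models\mathbf{N}\varphi$ iff $(\mathcal{M},a+1)\models\varphi$; $(\mathcal{M},a)\models\varphi\,\mathbf{S}\,\psi$ iff there is $b$ with $b\,R_a\,a$, $(\mathcal{M},b)\models\psi$ and $(\mathcal{M},c)\models\varphi$ for all $c$ with $a\le c<b$. $LTL_{Past,m}$ is the set of formulas true at all states of all such models. *)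

(* Defs.v *)
From mathcomp Require Import all_boot.
Set Implicit Arguments.
Unset Strict Implicit.
Unset Printing Implicit Defensive.

Definition letter := nat.

Inductive formula : Type :=
  | Var of letter
  | Neg of formula
  | And of formula & formula
  | Or of formula & formula
  | Imp of formula & formula
  | Next of formula
  | Since of formula & formula.

Definition valuation := letter -> nat -> Prop.

(* [R m i b a] is b R_i a: the order >= restricted to the interval
   [i, i + m]. *)
Definition R (m i : nat) : rel nat :=
  fun b a => [&& i <= a, a <= b & b <= i + m].

Fixpoint truth (m : nat) (V : valuation) (a : nat) (phi : formula) : Prop :=
  match phi with
  | Var p => V p a
  | Neg f => ~ truth m V a f
  | And f g => truth m V a f /\ truth m V a g
  | Or f g => truth m V a f \/ truth m V a g
  | Imp f g => truth m V a f -> truth m V a g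
  | Next f => truth m V a.+1 f
  | Since f g =>
      exists b, [/\ R m a b a, truth m V b g
                  & forall c, a <= c < b -> truth m V c f]
  end.

Definition LTL_Past (m : nat) (phi : formula) : Prop :=
  forall (V : valuation) (a : nat), truth m V a phi.

Definition satisfiable (m : nat) (phi : formula) : Prop :=
  exists (V : valuation) (a : nat), truth m V a phi.

(* Algorithms are programs for the partial recursive functions, in the unary
   presentation where several arguments are packed by Cantor's pairing.  A
   boolean function in the logic would not do: under classical axioms with
   choice, every predicate has one. *)

Definition cpair (x y : nat) : nat := 'C((x + y).+1, 2) + y.

Inductive prog : Type :=
  | PZero
  | PSucc
  | PFst
  | PSnd
  | PPair of prog & prog
  | PComp of prog & prog
  | PRec of prog & prog
  | PMin of prog.

(* [eval p x y]: on input x, p halts with output y.  In [EMin], h only records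
   the values of f below the least zero n, all of which must be defined. *)
Inductive eval : prog -> nat -> nat -> Prop :=
  | EZero x : eval PZero x 0
  | ESucc x : eval PSucc x x.+1
  | EFst x y : eval PFst (cpair x y) x
  | ESnd x y : eval PSnd (cpair x y) y
  | EPair f g x y z :
      eval f x y -> eval g x z -> eval (PPair f g) x (cpair y z)
  | EComp f g x y z :
      eval g x y -> eval f y z -> eval (PComp f g) x z
  | ERec0 f g x y :
      eval f x y -> eval (PRec f g) (cpair x 0) y
  | ERecS f g x n y z :
      eval (PRec f g) (cpair x n) y -> eval g (cpair x (cpair n y)) z ->
      eval (PRec f g) (cpair x n.+1) z
  | EMin f x n (h : nat -> nat) :
      eval f (cpair x n) 0 ->
      (forall k, k < n -> eval f (cpair x k) (h k).+1) ->
      eval (PMin f) x n.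

Lemma cpair_inj x y x' y' : cpair x y = cpair x' y' -> x = x' /\ y = y'.
Proof.
have lt_cpair u v u' v' : u + v < u' + v' -> cpair u v < cpair u' v'.
  move=> lt_s; rewrite /cpair.
  apply: (@leq_trans 'C((u + v).+2, 2)); last first.
    by apply: leq_trans (leq_addr _ _); apply: leq_bin2l.
  by rewrite [X in _ < X]binS bin1 ltn_add2l ltnS leq_addl.
move=> eq_c; have [lt_s|lt_s|eq_s] := ltngtP (x + y) (x' + y').
- by have := lt_cpair _ _ _ _ lt_s; rewrite eq_c ltnn.
- by have := lt_cpair _ _ _ _ lt_s; rewrite eq_c ltnn.
move: eq_c; rewrite /cpair eq_s => /addnI eq_y; split=> //.
by move: eq_s; rewrite eq_y => /addIn.
Qed.

Lemma eval_det p x y z : eval p x y -> eval p x z -> y = z.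
Proof.
move=> e; elim: e z => {p x y}
  [x|x|x y|x y|f g x y z _ IHf _ IHg|f g x y z _ IHg _ IHf|f g x y _ IHf
  |f g x n y z _ IHn _ IHg|f x n h _ IH0 _ IHh] w ew; inversion ew; subst;
  (repeat match goal with
  | E : cpair _ _ = cpair _ _ |- _ => case/cpair_inj: E => ? ?; subst
  | E : _.+1 = _.+1 |- _ => case: E => ?; subst
  end) => //.
- by congr cpair; [apply: IHf | apply: IHg].
- by apply: IHf; rewrite (IHg _ H1).
- exact: IHf.
- by apply: IHg; rewrite (IHn _ H2).
- have [lt_nw|lt_wn|//] := ltngtP n w.
    by have := IH0 _ (H1 _ lt_nw).
  by have := IHh _ lt_wn _ H0.
Qed.

Fixpoint code_formula (phi : formula) : nat :=
  match phi with
  | Var p => cpair 0 p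
  | Neg f => cpair 1 (code_formula f)
  | And f g => cpair 2 (cpair (code_formula f) (code_formula g))
  | Or f g => cpair 3 (cpair (code_formula f) (code_formula g))
  | Imp f g => cpair 4 (cpair (code_formula f) (code_formula g))
  | Next f => cpair 5 (code_formula f)
  | Since f g => cpair 6 (cpair (code_formula f) (code_formula g))
  end.

(* The output [b : bool] is read as 0 or 1. *)
Definition decidable_set (A : formula -> Prop) : Prop :=
  exists p : prog, forall phi : formula,
    exists b : bool, eval p (code_formula phi) b /\ (b <-> A phi).

(* A finite description of a valuation: the list of the pairs (p, a) such that
   the letter p is true at the state a. *)
Definition table := seq (letter * nat).

Definition table_valuation (t : table) : valuation :=
  fun p a => (p, a) \in t.

Definition code_table (t : table) : nat :=
  foldr (fun pa c => (cpair (cpair pa.1 pa.2) c).+1) 0 t.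

Definition code_answer (o : option table) : nat :=
  if o is Some t then (code_table t).+1 else 0.

(* p answers None on unsatisfiable formulas, and otherwise produces a
   valuation under which the formula is true at some state. *)
Definition satisfiability_algorithm (m : nat) (p : prog) : Prop :=
  forall phi : formula, exists o : option table,
    eval p (code_formula phi) (code_answer o) /\
    match o with
    | Some t => exists a : nat, truth m (table_valuation t) a phi
    | None => ~ satisfiable m phi
    end.

(* Main.v *)
(** The truth of [phi] at a state [a] depends only on the letters and states
    below a bound computable from the code of [phi].  So [phi] is satisfiable
    iff there is a finite labelling of the pairs (code of a formula, state) by
    truth values which obeys the truth clauses locally and makes [phi] true at
    the state 0.  A labelling is coded by the number [cpair b0 (cpair b1 ...)],
    where [bi] is the value of the pair coded by [i]; the numbers of this form
    are bounded, and local consistency is primitive recursive.  The clauses are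
    imposed on all numbers below the bound, which makes it unnecessary to
    recognise the codes or to recurse on formulas. *)
Require Import Defs.
From mathcomp Require Import all_boot zify.
From Stdlib Require Import Classical.

Set Implicit Arguments.
Unset Strict Implicit.
Unset Printing Implicit Defensive.

(** * Inverting Cantor's pairing *)

(** The walk along the antidiagonals: after (0, y) it starts the next one at (y + 1, 0). *)
Fixpoint unpair (n : nat) : nat * nat :=
  if n is k.+1 then
    let: (x, y) := unpair k in if x is x'.+1 then (x', y.+1) else (y.+1, 0)
  else (0, 0).

Definition cfst n := (unpair n).1.
Definition csnd n := (unpair n).2.

Arguments cfst : simpl never.
Arguments csnd : simpl never.

Lemma unpairK n : cpair (cfst n) (csnd n) = n.
Proof.
rewrite /cfst /csnd; elim: n => //= n.
case: (unpair n) => -[|x] y /= <-; rewrite /cpair.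
  by rewrite !add0n !addn0 binS bin1 addnS.
by rewrite addnS addSn addnS.
Qed.

Lemma cpairK x y : unpair (cpair x y) = (x, y).
Proof.
have := unpairK (cpair x y); rewrite /cfst /csnd.
by case: (unpair _) => u v /= /cpair_inj [-> ->].
Qed.

Lemma cfstK x y : cfst (cpair x y) = x.
Proof. by rewrite /cfst cpairK. Qed.

Lemma csndK x y : csnd (cpair x y) = y.
Proof. by rewrite /csnd cpairK. Qed.

Lemma leq_cpair x y x' y' : x <= x' -> y <= y' -> cpair x y <= cpair x' y'.
Proof.
by move=> lex ley; apply: leq_add => //; apply: leq_bin2l; rewrite ltnS leq_add.
Qed.

Lemma cfst_le n : cfst n <= n.
Proof.
rewrite -{2}(unpairK n) /cpair binS bin1; lia.
Qed.

Lemma csnd_le n : csnd n <= n.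
Proof. by rewrite -{2}(unpairK n) leq_addl. Qed.

(** A positive tag adds at least 1 through the binomial coefficient. So the arguments of a compound
    formula have smaller codes, which justifies recursion and induction on codes. *)
Lemma csnd_lt n : 0 < cfst n -> csnd n < n.
Proof.
move=> n_gt0; rewrite -{2}(unpairK n) /cpair binS bin1; lia.
Qed.

(** * Computable functions *)

Definition computable (f : nat -> nat) := exists p, forall x, eval p x (f x).

Lemma computable_ext f g : f =1 g -> computable f -> computable g.
Proof. by move=> eq_fg [p pf]; exists p => x; rewrite -eq_fg. Qed.

Lemma computable_comp f u :
  computable f -> computable u -> computable (fun x => f (u x)).
Proof. by move=> [p pf] [q qu]; exists (PComp p q) => x; apply: EComp. Qed.

Lemma computable_cfst u : computable u -> computable (fun x => cfst (u x)).
Proof.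
apply: computable_comp; exists PFst => x; rewrite -{1}(unpairK x); exact: EFst.
Qed.

Lemma computable_csnd u : computable u -> computable (fun x => csnd (u x)).
Proof.
apply: computable_comp; exists PSnd => x; rewrite -{1}(unpairK x); exact: ESnd.
Qed.

Lemma computable_cpair u v :
  computable u -> computable v -> computable (fun x => cpair (u x) (v x)).
Proof. by move=> [p pu] [q qv]; exists (PPair p q) => x; apply: EPair. Qed.

Lemma computable_id : computable (fun x => x).
Proof.
by exists (PPair PFst PSnd) => x; rewrite -(unpairK x); apply: EPair;
  [apply: EFst | apply: ESnd].
Qed.

Lemma computable_succ u : computable u -> computable (fun x => (u x).+1).
Proof. by apply: computable_comp; exists PSucc => x; apply: ESucc. Qed.

Lemma computable_const k : computable (fun=> k).
Proof.
elim: k => [|k IHk]; last exact: computable_succ.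
by exists PZero => x; apply: EZero.
Qed.

Lemma computable_addl k u : computable u -> computable (fun x => k + u x).
Proof. by move=> cu; elim: k => // k; apply: computable_succ. Qed.

(** [PRec] keeps x as a parameter; composition with the pairing of x and [n x] then sets the length
    of the recursion. *)
Lemma computable_iteri n g x0 :
    computable n -> computable x0 ->
    computable (fun w => g (cfst w) (cfst (csnd w)) (csnd (csnd w))) ->
  computable (fun x => iteri (n x) (g x) (x0 x)).
Proof.
move=> cn [p px0] [q qg].
have cr : computable (fun w => iteri (csnd w) (g (cfst w)) (x0 (cfst w))).
  exists (PRec p q) => w; rewrite -{1}(unpairK w); move: (cfst w) (csnd w) => x.
  elim=> [|k IHk] /=; first exact: ERec0.
  apply: ERecS IHk _; set y := iteri _ _ _.
  by have := qg (cpair x (cpair k y)); rewrite !(cfstK, csndK).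
have cxn := computable_cpair computable_id cn.
by apply: computable_ext (computable_comp cr cxn) => x; rewrite cfstK csndK.
Qed.

(** A conditional is a recursion of length [b x], 0 or 1, whose step ignores the accumulator. *)
Lemma computable_if (b : nat -> bool) u v :
    computable (fun x => b x) -> computable u -> computable v ->
  computable (fun x => if b x then u x else v x).
Proof.
move=> cb cu cv.
apply: (@computable_ext (fun x => iteri (b x) (fun _ _ => u x) (v x))).
  by move=> x; case: (b x).
apply: computable_iteri => //.
exact/(computable_comp cu)/computable_cfst/computable_id.
Qed.

Lemma computable_neg (b : nat -> bool) :
  computable (fun x => b x) -> computable (fun x => ~~ b x).
Proof.
move=> cb.
apply: computable_ext
  (computable_if cb (computable_const 0) (computable_const 1)).
by move=> x; case: (b x).
Qed.

Lemma computable_and (b c : nat -> bool) :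
    computable (fun x => b x) -> computable (fun x => c x) ->
  computable (fun x => b x && c x).
Proof.
move=> cb cc; apply: computable_ext (computable_if cb cc (computable_const 0)).
by move=> x; case: (b x).
Qed.

Lemma computable_or (b c : nat -> bool) :
    computable (fun x => b x) -> computable (fun x => c x) ->
  computable (fun x => b x || c x).
Proof.
move=> cb cc; apply: computable_ext (computable_if cb (computable_const 1) cc).
by move=> x; case: (b x).
Qed.

Lemma computable_ifb (b c d : nat -> bool) :
    computable (fun x => b x) -> computable (fun x => c x) ->
    computable (fun x => d x) ->
  computable (fun x => if b x then c x else d x).
Proof.
move=> cb cc cd; apply: computable_ext (computable_if cb cc cd) => x.
by case: (b x).
Qed.

Lemma computable_eqb (b c : nat -> bool) :
    computable (fun x => b x) -> computable (fun x => c x) ->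
  computable (fun x => b x == c x).
Proof.
move=> cb cc.
apply: computable_ext (computable_if cb cc (computable_neg cc)) => x.
by case: (b x) (c x) => [] [].
Qed.

Lemma computable_pred u : computable u -> computable (fun x => (u x).-1).
Proof.
move=> cu.
apply: (@computable_ext (fun x => iteri (u x) (fun k _ => k) 0)).
  by move=> x; case: (u x).
apply: computable_iteri => //; first exact: computable_const.
exact/computable_cfst/computable_csnd/computable_id.
Qed.

Lemma computable_eq0 u : computable u -> computable (fun x => u x == 0).
Proof.
move=> cu; apply: (@computable_ext (fun x => iteri (u x) (fun _ _ => 0) 1)).
  by move=> x; case: (u x).
by apply: computable_iteri => //; apply: computable_const.
Qed.

Lemma computable_eqn k u : computable u -> computable (fun x => u x == k).
Proof.
elim: k u => [|k IHk] u cu; first exact: computable_eq0.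
apply: (@computable_ext (fun x => (u x != 0) && ((u x).-1 == k))).
  by move=> x; case: (u x).
apply: computable_and; last exact/IHk/computable_pred.
exact/computable_neg/computable_eq0.
Qed.

Lemma computable_all (b : nat -> nat -> bool) n :
    computable n -> computable (fun w => b (cfst w) (csnd w)) ->
  computable (fun x => all (b x) (iota 0 (n x))).
Proof.
move=> cn cb.
apply: (@computable_ext
  (fun x => iteri (n x) (fun k y => if b x k then y else 0) 1)).
  move=> x; elim: (n x) => [//|k IHk].
  by rewrite -[in RHS]addn1 iotaD all_cat /= IHk add0n andbT andbC;
    case: (b x k).
apply: computable_iteri => //; first exact: computable_const.
have cid := computable_id.
apply: computable_if; [|exact/computable_csnd/computable_csnd|]; last first.
  exact: computable_const.
have cw : computable (fun w => cpair (cfst w) (cfst (csnd w))).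
  apply: computable_cpair; first exact: computable_cfst.
  exact/computable_cfst/computable_csnd.
by apply: computable_ext (computable_comp cb cw) => w; rewrite cfstK csndK.
Qed.

(** * Labellings *)

(** Any nonzero entry reads as true, so every number is a labelling. *)
Definition bit (s i : nat) : bool := cfst (iteri i (fun _ => csnd) s) != 0.

(** The code of the all-true labelling of length n, the greatest code with entries 0 and 1 because
    pairing is monotone. *)
Definition bound (n : nat) : nat := iteri n (fun _ => cpair 1) 0.

(** Excluded middle chooses each bit, so P may be truth in an arbitrary model. *)
Lemma bits_exist n (P : nat -> Prop) :
  exists2 s, s <= bound n & forall i, i < n -> bit s i <-> P i.
Proof.
elim: n P => [|n IHn] P; first by exists 0.
have [s le_s bit_s] := IHn (fun i => P i.+1).
have [b Pb] : exists b : bool, b <-> P 0.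
  by case: (classic (P 0)) => P0; [exists true | exists false].
exists (cpair b s); first by apply: leq_cpair => //; case: (b).
have iter_csnd i t : iteri i.+1 (fun=> csnd) t = iteri i (fun=> csnd) (csnd t).
  by elim: i => //= i ->.
case=> [_|i lt_i]; rewrite /bit; last by rewrite iter_csnd csndK; apply: bit_s.
by rewrite /= cfstK -Pb; case: (b).
Qed.

(** * Local truth clauses *)

(** The expansion law of the bounded since: either G holds now, or F holds now and the since with a
    window shorter by one holds at the next state. *)
Fixpoint since (m : nat) (F G : nat -> bool) (a : nat) : bool :=
  G a || (if m is k.+1 then F a && since k F G a.+1 else false).

Lemma sinceP m F G a :
  since m F G a <->
  exists j, [/\ j <= m, G (a + j) & forall k, k < j -> F (a + k)].
Proof.
elim: m a => [|m IHm] a /=.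
  rewrite orbF; split=> [Ga|[j [+ Gj _]]]; first by exists 0; rewrite addn0.
  by rewrite leqn0 => /eqP j0; rewrite j0 addn0 in Gj.
split=> [/orP [Ga|/andP [Fa /IHm [j [le_j Gj Fj]]]]|[j [le_j Gj Fj]]].
- by exists 0; rewrite addn0.
- exists j.+1; split=> //; first by rewrite addnS -addSn.
  by case=> [|k] lt_k; rewrite ?addn0 // addnS -addSn; apply: Fj.
case: j => [|j] in le_j Gj Fj *; first by rewrite addn0 in Gj; rewrite Gj.
apply/orP; right; apply/andP; split; first by rewrite -[a]addn0; apply: Fj.
apply/IHm; exists j; split=> //; first by rewrite addSn -addnS.
by move=> k lt_k; rewrite addSn -addnS; apply: Fj.
Qed.

(* The tags above 6, which code no formula, are treated as the tag 6. *)
Definition step (m : nat) (L : nat -> nat -> bool) (c a : nat) : bool :=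
  let t := cfst c in let x := csnd c in
  if t == 0 then L c a
  else if t == 1 then ~~ L x a
  else if t == 2 then L (cfst x) a && L (csnd x) a
  else if t == 3 then L (cfst x) a || L (csnd x) a
  else if t == 4 then ~~ L (cfst x) a || L (csnd x) a
  else if t == 5 then L x a.+1
  else since m (L (cfst x)) (L (csnd x)) a.

(** * Decoding of formulas *)

(** Here n is fuel, and [Var 0] is the value when it runs out. Every number decodes to some formula,
    with tags above 6 read as in [step]. *)
Fixpoint decode (n c : nat) : formula :=
  if n isn't n'.+1 then Var 0 else
  let t := cfst c in let x := csnd c in
  let d := decode n' in
  if t == 0 then Var x
  else if t == 1 then Neg (d x)
  else if t == 2 then And (d (cfst x)) (d (csnd x))
  else if t == 3 then Or (d (cfst x)) (d (csnd x))
  else if t == 4 then Imp (d (cfst x)) (d (csnd x))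
  else if t == 5 then Next (d x)
  else Since (d (cfst x)) (d (csnd x)).

Definition formula_of (c : nat) : formula := decode c.+1 c.

Lemma decode_fuel n n' c : c < n -> c < n' -> decode n c = decode n' c.
Proof.
elim: n n' c => // n IHn [|n'] c //; rewrite !ltnS => le_n le_n' /=.
case: eqP => // /eqP; rewrite -lt0n => /csnd_lt lt_x.
have lt_fx := leq_ltn_trans (cfst_le _) lt_x.
have lt_gx := leq_ltn_trans (csnd_le _) lt_x.
have eq_d y : y < c -> decode n y = decode n' y.
  by move=> lt_y; apply: IHn; apply: leq_trans lt_y _.
by rewrite !eq_d.
Qed.

Lemma formula_ofE c :
  formula_of c =
  let t := cfst c in let x := csnd c in
  if t == 0 then Var x
  else if t == 1 then Neg (formula_of x)
  else if t == 2 then And (formula_of (cfst x)) (formula_of (csnd x))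
  else if t == 3 then Or (formula_of (cfst x)) (formula_of (csnd x))
  else if t == 4 then Imp (formula_of (cfst x)) (formula_of (csnd x))
  else if t == 5 then Next (formula_of x)
  else Since (formula_of (cfst x)) (formula_of (csnd x)).
Proof.
rewrite {1}/formula_of /=.
case: eqP => // /eqP; rewrite -lt0n => /csnd_lt lt_x.
have lt_fx := leq_ltn_trans (cfst_le _) lt_x.
have lt_gx := leq_ltn_trans (csnd_le _) lt_x.
have eq_d y : y < c -> decode c y = formula_of y.
  by move=> lt_y; apply: decode_fuel.
by rewrite !eq_d.
Qed.

Lemma code_formulaK phi : formula_of (code_formula phi) = phi.
Proof.
elim: phi => *; rewrite [code_formula _]/= formula_ofE; cbv zeta;
  rewrite !(cfstK, csndK) /=; congruence.
Qed.

(** A clause consults only smaller codes, at most m + 1 states ahead: [Next] looks 1 ahead and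
    [Since] at most m. The offset d lets a labelling describe a model from its state d on. *)
Lemma step_truth m V (L : nat -> nat -> bool) c a d :
    0 < cfst c ->
    (forall c' j, c' < c -> j <= m.+1 ->
      L c' (a + j) <-> truth m V (d + (a + j)) (formula_of c')) ->
  step m L c a <-> truth m V (d + a) (formula_of c).
Proof.
move=> c_gt0 L_truth; rewrite formula_ofE /step /=.
have lt_x := csnd_lt c_gt0.
have lt_fx := leq_ltn_trans (cfst_le _) lt_x.
have lt_gx := leq_ltn_trans (csnd_le _) lt_x.
have L0 c' : c' < c -> L c' a <-> truth m V (d + a) (formula_of c').
  by move=> lt_c; have := L_truth c' 0 lt_c; rewrite addn0; apply.
move: (L0 _ lt_x) (L0 _ lt_fx) (L0 _ lt_gx) => Lx Lf Lg.
rewrite gtn_eqF //; case: eqP => _ /=.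
  by rewrite -Lx; split=> [/negP|/negP].
case: eqP => _ /=; first by rewrite -Lf -Lg; split=> /andP.
case: eqP => _ /=; first by rewrite -Lf -Lg; split=> /orP.
case: eqP => _ /=; first by rewrite -Lf -Lg -implybE; split=> /implyP.
case: eqP => _ /=.
  by have := L_truth _ 1 lt_x isT; rewrite addn1 addnS.
rewrite sinceP; split=> [[j [le_j Gj Fj]]|[b [Rb Gb Fb]]].
  exists (d + (a + j)); split.
  - by rewrite /R; lia.
  - by apply/L_truth => //; apply: leqW.
  move=> e /andP [le_e lt_e]; have -> : e = d + (a + (e - (d + a))) by lia.
  by apply/L_truth => //; [lia | apply: Fj; lia].
have [j def_b] : exists j, b = d + (a + j).
  by exists (b - (d + a)); move: Rb; rewrite /R; lia.
move: Rb; rewrite def_b /R => Rb; rewrite {}def_b in Gb Fb.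
exists j; split; first by lia.
  by apply/L_truth => //; lia.
by move=> k lt_k; apply/L_truth => //; [lia | apply: Fb; lia].
Qed.

(* [c * m.+1] bounds how far beyond the current state the formula coded by [c]
   looks. *)
Definition horizon (m c : nat) : nat := iteri c (fun _ y => m.+1 + y) 0.

Lemma horizonE m c : horizon m c = c * m.+1.
Proof. by elim: c => //= c ->; rewrite mulSn. Qed.

(** Monotonicity of pairing puts below this number all pairs of a code at most c and a state within
    the horizon. *)
Definition nchecks (m c : nat) : nat := (cpair c (horizon m c)).+1.

(** * Consistent labellings and their models *)

Definition consistent (m s n : nat) : bool :=
  let L c a := bit s (cpair c a) in
  all (fun i => L (cfst i) (csnd i) == step m L (cfst i) (csnd i)) (iota 0 n).

Definition table_of (s n : nat) : table :=
  iteri n (fun i t =>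
    if bit s i && (cfst (cfst i) == 0) then (csnd (cfst i), csnd i) :: t else t)
    [::].

Lemma table_ofP s n p a :
  cpair (cpair 0 p) a < n ->
  table_valuation (table_of s n) p a <-> bit s (cpair (cpair 0 p) a).
Proof.
rewrite /table_valuation => lt_n; suff -> : ((p, a) \in table_of s n) =
    (cpair (cpair 0 p) a < n) && bit s (cpair (cpair 0 p) a) by rewrite lt_n.
elim: n {lt_n} => //= n IHn; rewrite ltnS leq_eqVlt andb_orl -{}IHn.
have [<-|ne_n] /= := eqVneq (cpair (cpair 0 p) a) n.
  by rewrite !(cfstK, csndK) /= andbT; case: bit; rewrite ?inE ?eqxx.
case: ifP => // /andP [_ /eqP t0]; rewrite inE [_ == _]negbTE //.
apply: contraNneq ne_n => -[-> ->].
by rewrite -[in X in cpair (cpair X _)]t0 !unpairK.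
Qed.

(** Strong induction on c. The bound on [a + c * m.+1] keeps every pair that is visited among those
    checked. *)
Lemma consistent_truth m s N :
    consistent m s (nchecks m N) ->
  forall c a, c <= N -> a + c * m.+1 <= N * m.+1 ->
  bit s (cpair c a) <->
  truth m (table_valuation (table_of s (nchecks m N))) a (formula_of c).
Proof.
move=> cons; move: (@table_ofP s (nchecks m N)); move: (table_of s _) => t tP.
move=> c; have [n] := ubnP c; elim: n c => // n IHn c lt_c a le_c le_a.
have lt_i : cpair c a < nchecks m N.
  by rewrite /nchecks ltnS horizonE leq_cpair //; lia.
have [c0|c_gt0] := posnP (cfst c).
  by have := tP (csnd c) a; rewrite formula_ofE c0 /= -c0 unpairK => ->.
have /(_ (cpair c a)) := allP cons; rewrite mem_iota lt_i cfstK csndK.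
move=> /(_ isT) /eqP ->.
apply: (@step_truth m _ (fun c a => bit s (cpair c a)) c a 0) => //.
move=> c' j lt_c' le_j.
(* A smaller code frees m + 1 units of the budget, enough for the states that a clause looks
   ahead. *)
have: c' * m.+1 + m.+1 <= c * m.+1 by rewrite addnC -mulSn leq_mul.
by move=> le_c'; apply: IHn; lia.
Qed.

(** Label each pair by the truth of the decoded formula, with states shifted by d. Since every
    number decodes, this labelling obeys all the clauses, and truth at d becomes the label at state
    0. *)
Lemma consistent_exists m V d N n :
  exists2 s, s <= bound (cpair n (m.+1 + n)).+1 &
    consistent m s n /\
    (cpair N 0 < n -> bit s (cpair N 0) <-> truth m V d (formula_of N)).
Proof.
(* A pair coded below n has both components below or at n, and its clause reads up to m + 1 states
   further. *)
have [s le_s bit_s] := bits_exist (cpair n (m.+1 + n)).+1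
  (fun i => truth m V (d + csnd i) (formula_of (cfst i))).
have L_truth c a : c <= n -> a <= m.+1 + n ->
    bit s (cpair c a) <-> truth m V (d + a) (formula_of c).
  move=> le_c le_a; rewrite bit_s ?ltnS ?leq_cpair //.
  by rewrite cfstK csndK.
exists s => //; split; last first.
  move=> lt_n; have := cfst_le (cpair N 0); rewrite cfstK => le_N.
  by have := L_truth N 0; rewrite addn0; apply; lia.
apply/allP => i; rewrite mem_iota add0n => /= lt_i.
have le_c : cfst i <= n by have := cfst_le i; lia.
have le_a : csnd i <= n by have := csnd_le i; lia.
(* The clause of a letter compares its label with itself. *)
have [c0|c_gt0] := posnP (cfst (cfst i)); first by rewrite /step c0 eqxx.
have st_truth : step m (fun c a => bit s (cpair c a)) (cfst i) (csnd i) <->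
    truth m V (d + csnd i) (formula_of (cfst i)).
  by apply: step_truth => // c' j lt_c' le_j; apply: L_truth; lia.
have bit_truth : bit s (cpair (cfst i) (csnd i)) <->
    truth m V (d + csnd i) (formula_of (cfst i)) by apply: L_truth; lia.
by apply/eqP; apply/idP/idP => [/bit_truth/st_truth|/st_truth/bit_truth].
Qed.

(* [(search m c).-1] codes the labelling found; [search m c] is 0 if there is
   none. *)
Definition search (m c : nat) : nat :=
  let n := nchecks m c in
  iteri (bound (cpair n (m.+1 + n)).+1).+1
    (fun s y => if consistent m s n && bit s (cpair c 0) then s.+1 else y) 0.

(** Each success overwrites the result, so the greatest solution survives; storing its successor
    leaves 0 for failure. *)
Lemma iteri_searchP (P : pred nat) n :
  if iteri n (fun s y => if P s then s.+1 else y) 0 is s.+1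
  then P s else forall s, s < n -> ~~ P s.
Proof.
elim: n => //= n; case: ifP => // /negbT NPn.
case: (iteri _ _ _) => // Pn s.
by rewrite ltnS leq_eqVlt => /predU1P [->|/Pn].
Qed.

Lemma searchP m phi :
  if search m (code_formula phi) is s.+1
  then truth m
    (table_valuation (table_of s (nchecks m (code_formula phi)))) 0 phi
  else ~ satisfiable m phi.
Proof.
move: (code_formula phi) (code_formulaK phi) => c Ec; rewrite /search.
have := consistent_exists m _ _ c (nchecks m c).
have := @consistent_truth m _ c.
have lt_c : cpair c 0 < nchecks m c by rewrite ltnS leq_cpair.
move: (nchecks m c) lt_c => n lt_c sound complete.
move: (bound _) complete => b complete.
have := iteri_searchP (fun s => consistent m s n && bit s (cpair c 0)) b.+1.
case: (iteri _ _ _) => [none [V [a tr]]|s /andP [cons bit_s]].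
  have [s le_s [cons bit_s]] := complete V a.
  have := none s; rewrite ltnS cons le_s => /(_ isT) /negP; apply.
  by apply/bit_s => //; rewrite Ec.
by rewrite -Ec; apply/sound.
Qed.

(** * Computability of the search *)

Lemma computable_bit u v :
  computable u -> computable v -> computable (fun x => bit (u x) (v x)).
Proof.
move=> cu cv; apply/computable_neg/computable_eq0/computable_cfst.
apply: computable_iteri => //.
exact/computable_csnd/computable_csnd/computable_csnd/computable_id.
Qed.

Lemma computable_bound u : computable u -> computable (fun x => bound (u x)).
Proof.
move=> cu; apply: computable_iteri => //; first exact: computable_const.
apply: computable_cpair; first exact: computable_const.
exact/computable_csnd/computable_csnd/computable_id.
Qed.

Lemma computable_nchecks m u :
  computable u -> computable (fun x => nchecks m (u x)).
Proof.
move=> cu; apply/computable_succ/computable_cpair => //.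
apply: computable_iteri => //; first exact: computable_const.
exact/computable_addl/computable_csnd/computable_csnd/computable_id.
Qed.

Ltac prove_computable :=
  cbv zeta;
  repeat lazymatch goal with
  | |- computable (fun _ => cfst _) => apply: computable_cfst
  | |- computable (fun _ => csnd _) => apply: computable_csnd
  | |- computable (fun _ => cpair _ _) => apply: computable_cpair
  | |- computable (fun _ => _ + _) => apply: computable_addl
  | |- computable (fun _ => iteri _ _ _) => apply: computable_iteri
  | |- computable (fun _ => bound _) => apply: computable_bound
  | |- computable (fun _ => nchecks _ _) => apply: computable_nchecks
  | |- computable (fun _ => nat_of_bool (~~ _)) => apply: computable_neg
  | |- computable (fun _ => nat_of_bool (_ && _)) => apply: computable_and
  | |- computable (fun _ => nat_of_bool (_ || _)) => apply: computable_or
  | |- computable (fun _ => nat_of_bool (bit _ _)) => apply: computable_bit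
  | |- computable (fun _ => nat_of_bool (_ == _)) =>
      first [apply: computable_eqn | apply: computable_eqb]
  | |- computable (fun _ => nat_of_bool (if _ then _ else _)) =>
      apply: computable_ifb
  | |- computable (fun _ => if _ then _ else _) => apply: computable_if
  | |- computable (fun _ => _) =>
      first [ assumption | exact: computable_id | exact: computable_const
            | apply: computable_succ | apply: computable_pred ]
  | |- computable ?f => first [assumption | change (computable (fun x => f x))]
  end.

(** As m is fixed, the expansion law is unrolled m times into the program. Each level moves to the
    next state, so F and G are assumed computable at every computable argument. *)
Lemma computable_since m (F G : nat -> nat -> bool) u :
    (forall v, computable v -> computable (fun x => F x (v x))) ->
    (forall v, computable v -> computable (fun x => G x (v x))) ->
    computable u ->
  computable (fun x => since m (F x) (G x) (u x)).
Proof.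
move=> cF cG; elim: m u => [|m IHm] u cu /=; have cGu := cG _ cu.
  by prove_computable; apply: (computable_const 0).
have cFu := cF _ cu; have := IHm _ (computable_succ cu).
by move=> c; prove_computable.
Qed.

Lemma computable_step m u v w :
    computable u -> computable v -> computable w ->
  computable (fun x => step m (fun c a => bit (u x) (cpair c a)) (v x) (w x)).
Proof.
move=> cu cv cw; rewrite /step.
have cs : computable (fun x => since m
    (fun a => bit (u x) (cpair (cfst (csnd (v x))) a))
    (fun a => bit (u x) (cpair (csnd (csnd (v x))) a)) (w x)).
  by apply: computable_since => // t ct; prove_computable.
by prove_computable.
Qed.

Lemma computable_consistent m u n :
    computable u -> computable n ->
  computable (fun x => consistent m (u x) (n x)).
Proof.
move=> cu cn; apply: computable_all => //.
have cus : computable (fun w => u (cfst w)).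
  exact: (computable_comp cu (computable_cfst computable_id)).
have ci := computable_csnd computable_id.
apply: computable_eqb.
  exact: (computable_bit cus
    (computable_cpair (computable_cfst ci) (computable_csnd ci))).
exact: (computable_step m cus (computable_cfst ci) (computable_csnd ci)).
Qed.

Lemma computable_search m : computable (search m).
Proof.
rewrite /search; prove_computable.
by apply: computable_consistent; prove_computable.
Qed.

(** Moves the recursion from lists to their codes, where [computable_iteri] applies. *)
Lemma code_table_of s n :
  code_table (table_of s n) =
  iteri n (fun i t =>
    if bit s i && (cfst (cfst i) == 0)
    then (cpair (cpair (csnd (cfst i)) (csnd i)) t).+1 else t) 0.
Proof. by elim: n => //= n <-; case: ifP. Qed.

Lemma computable_code_table_of u n :
    computable u -> computable n ->
  computable (fun x => code_table (table_of (u x) (n x))).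
Proof.
move=> cu cn.
apply: computable_ext (fun x => esym (code_table_of (u x) (n x))) _.
have cus : computable (fun w => u (cfst w)).
  exact: (computable_comp cu (computable_cfst computable_id)).
by prove_computable.
Qed.

(** * The decision procedures *)

Lemma decidable_set_computable (b : nat -> bool) (A : formula -> Prop) :
    computable (fun c => b c) ->
    (forall phi, b (code_formula phi) <-> A phi) ->
  decidable_set A.
Proof.
by move=> [p pb] bA; exists p => phi; exists (b (code_formula phi)).
Qed.

Lemma satisfiable_search m phi :
  search m (code_formula phi) != 0 <-> satisfiable m phi.
Proof.
have := searchP m phi; move: (nchecks _ _) => n.
case: (search _ _) => [|s] // tr; split=> // _.
by exists (table_valuation (table_of s n)), 0.
Qed.

Theorem theorem2 (m : nat) :
  decidable_set (LTL_Past m) /\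
  decidable_set (satisfiable m) /\
  exists p : prog, satisfiability_algorithm m p.
Proof.
have cs := computable_search m.
split; [|split].
(* A formula is valid iff its negation, coded by [cpair 1 c], is unsatisfiable; one direction is
   classical. *)
- apply: (@decidable_set_computable (fun c => search m (cpair 1 c) == 0)).
    by apply/computable_eqn/(computable_comp cs); prove_computable.
  move=> phi; have := satisfiable_search m (Neg phi).
  rewrite [code_formula _]/= => sat; split=> [/negPn unsat V a|valid].
    by apply: NNPP => ntr; apply: (negP unsat); apply/sat; exists V, a.
  by apply/negPn/negP => /sat [V [a]]; apply; apply: valid.
- apply: (@decidable_set_computable (fun c => search m c != 0)).
    by prove_computable.
  exact: satisfiable_search.
(* The predecessor recovers the labelling; when the search fails, the resulting table is
   discarded. *)
pose t c := table_of (search m c).-1 (nchecks m c).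
have [p evp] : computable (fun c =>
    if search m c == 0 then 0 else (code_table (t c)).+1).
  by prove_computable; apply: computable_code_table_of; prove_computable.
exists p => phi; set c := code_formula phi.
exists (if search m c == 0 then None else Some (t c)); split.
  by have := evp c; case: ifP.
have := searchP m phi; rewrite /t -/c; move: (nchecks m c) => n.
by case: (search m c) => // s tr; exists 0.
Qed.
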